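(* Let $M=(M_n)_{n\ge 0}$ be the Thue--Morse sequence and let $\theta=(\theta_n)_{n\ge 0}\in\{0,1,2\}^{\mathbb{N}}$ be given by $\theta_0=M_0=0$ and, for $n\ge 1$, $\theta_n=2$ if $M_n=M_{n-1}$ and $\theta_n=M_n$ otherwise. For pairwise distinct positive integers $p,q,r$, let $\beta=(\beta_n)_{n\ge 0}$ be the sequence obtained from $\theta$ by replacing the letters $0,1,2$ by $p,q,r$ respectively, and let $$\alpha_{p,q,r}=1^{\beta_0}\,0\,1^{\beta_1}\,0\,1^{\beta_2}\,0\cdots\in\{0,1\}^{\mathbb{N}},$$ where $1^{k}$ denotes a block of $k$ consecutive $1$'s. Then for all pairwise distinct positive integers $p,q,r$ the point $\alpha_{p,q,r}$ is recurrent under the shift $\sigma$, and its orbit closure $\overline{\mathcal{O}_\sigma(\alpha_{p,q,r})}$ is minimal and uncountable. Moreover, there are infinitely many points of the form $\alpha_{p,q,r}$ such that the orbit closures of any two distinct ones among them are disjoint.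
   Context: The Thue--Morse sequence $M=(M_n)_{n\ge 0}=0110100110010110\cdots$ is the limit of the words $M^{2^n}$ of length $2^n$ defined by: the initial word (length $1$) is $0$, and $M^{2^{n+1}}=M^{2^n}\,\overline{M^{2^n}}$, where $\overline{W}$ is the word obtained from $W$ by switching $0$ and $1$. Equivalently, $M_0=0$, $M_{2n}=M_n$, $M_{2n+1}=1-M_n$. The space $\{0,1\}^{\mathbb{N}}$ of one-sided sequences carries the product topology, and $\sigma$ is the shift map $\sigma(x_0x_1x_2\cdots)=x_1x_2x_3\cdots$. For $x\in\{0,1\}^{\mathbb{N}}$, $\mathcal{O}_\sigma(x)=\{\sigma^n(x):n\ge 0\}$ and $\overline{\mathcal{O}_\sigma(x)}$ is its closure. A point $x$ is recurrent if for every neighborhood $U$ of $x$ there is $n\ge 1$ with $\sigma^n(x)\in U$. A set $X$ (with $\sigma$ acting on it) is minimal if it contains no proper, closed, nonempty, forward $\sigma$-invariant subset. *)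

(* Defs.v *)
From mathcomp Require Import all_boot.
From mathcomp Require Import all_classical topology cantor.

Set Implicit Arguments.
Unset Strict Implicit.
Unset Printing Implicit Defensive.

Local Open Scope classical_set_scope.

(* Topological dynamics of a self-map [f]; [iter n f] is the n-th power. *)

Definition orbit_of {T : Type} (f : T -> T) (x : T) : set T :=
  [set y | exists n : nat, y = iter n f x].

Definition orbit_closure {T : topologicalType} (f : T -> T) (x : T) : set T :=
  closure (orbit_of f x).

Definition recurrent {T : topologicalType} (f : T -> T) (x : T) : Prop :=
  forall U : set T, nbhs x U -> exists n : nat, (1 <= n)%N /\ U (iter n f x).

(* "Closed" means closed in [T]; this agrees with "closed in X" whenever X is
   closed, as orbit closures are. *)
Definition minimal_set {T : topologicalType} (f : T -> T) (X : set T) : Prop :=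
  ~ exists Y : set T, [/\ Y `<` X, closed Y, Y !=set0 & f @` Y `<=` Y].

(* [cantor_space] is nat -> bool with the product topology; the letters 0 and 1
   are [false] and [true]. *)
Definition shift_map (x : cantor_space) : cantor_space := fun n => x n.+1.

(* [tm_word n] is the prefix of length 2 ^ n of the Thue-Morse sequence. *)
Fixpoint tm_word (n : nat) : seq bool :=
  if n is m.+1 then tm_word m ++ map negb (tm_word m) else [:: false].

(* Reading letter n off the prefix of length 2 ^ n > n; any longer prefix gives
   the same letter (nth_tm_word). *)
Definition thue_morse (n : nat) : bool := nth false (tm_word n) n.

Definition theta (n : nat) : 'I_3 :=
  if n is m.+1 then
    if thue_morse m.+1 == thue_morse m then inord 2
    else inord (thue_morse m.+1 : nat)
  else inord (thue_morse 0 : nat).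

Definition beta (p q r n : nat) : nat := tnth [tuple p; q; r] (theta n).

(* The word 1^(b 0) 0 1^(b 1) 0 ... 1^(b (n-1)) 0. *)
Definition block_word (b : nat -> nat) (n : nat) : seq bool :=
  flatten (mkseq (fun i => rcons (nseq (b i) true) false) n).

(* The infinite word 1^(b 0) 0 1^(b 1) 0 ...: its first n + 1 blocks have total
   length > n and so determine letter n (nth_block_word). *)
Definition block_seq (b : nat -> nat) : cantor_space :=
  fun n => nth false (block_word b n.+1) n.

Definition alpha (p q r : nat) : cantor_space := block_seq (beta p q r).

Definition distinct_pos (p q r : nat) : bool :=
  [&& (0 < p)%N, (0 < q)%N, (0 < r)%N, p != q, p != r & q != r].

Lemma size_tm_word n : size (tm_word n) = (2 ^ n)%N.
Proof.
elim: n => [|n IHn] //=.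
by rewrite size_cat size_map IHn addnn -mul2n -expnS.
Qed.

Lemma nth_tm_word n i : (i < 2 ^ n)%N -> nth false (tm_word n) i = thue_morse i.
Proof.
have ext m k j : (j < 2 ^ m)%N ->
    nth false (tm_word (m + k)) j = nth false (tm_word m) j.
  elim: k => [|k IHk] lt_j; first by rewrite addn0.
  rewrite addnS /= nth_cat size_tm_word (leq_trans lt_j) ?IHk //.
  by rewrite leq_exp2l // leq_addr.
move=> lt_i; rewrite /thue_morse.
have [le_ni|/ltnW le_in] := leqP n i.
  by rewrite -(subnKC le_ni) ext // subnKC.
by rewrite -{1}(subnKC le_in) ext // ltn_expl.
Qed.

Lemma block_wordS b n :
  block_word b n.+1 = block_word b n ++ rcons (nseq (b n) true) false.
Proof. by rewrite /block_word mkseqS flatten_rcons. Qed.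

Lemma nth_block_word b n i : (i < size (block_word b n))%N ->
  nth false (block_word b n) i = block_seq b i.
Proof.
have ext m k j : (j < size (block_word b m))%N ->
    (j < size (block_word b (m + k)))%N /\
    nth false (block_word b (m + k)) j = nth false (block_word b m) j.
  move=> lt_j; elim: k => [|k [lt_jk IHk]]; first by rewrite addn0.
  by rewrite addnS block_wordS nth_cat size_cat lt_jk ltn_addr.
have size_ge m : (m <= size (block_word b m))%N.
  elim: m => // m IHm; rewrite block_wordS size_cat size_rcons addnS ltnS.
  exact: leq_trans IHm (leq_addr _ _).
move=> lt_i; rewrite /block_seq.
have [le_ni|/ltnW le_in] := leqP n i.+1.
  by rewrite -{1}(subnKC le_ni) (ext n _ i lt_i).2.
by rewrite -{1}(subnKC le_in) (ext i.+1 _ i (size_ge _)).2.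
Qed.

(* Main.v *)
Require Import Defs.
From mathcomp Require Import all_boot.
From mathcomp Require Import all_classical topology cantor.
From mathcomp Require Import zify.

Set Implicit Arguments.
Unset Strict Implicit.
Unset Printing Implicit Defensive.

Local Open Scope classical_set_scope.

(** Call a sequence uniformly recurrent when each of its prefixes reappears
    with bounded gaps.  Everything about a single point follows from two
    properties of [alpha]: it is uniformly recurrent and it is not eventually
    periodic.  Indeed a uniformly recurrent [x] is recurrent, and its orbit
    closure is minimal because every point [y] of that closure has long
    prefixes that are factors of [x], so that every prefix of [x] is visible in
    [y] ([minimal_of_uniformly]).  If [x] is moreover not eventually periodic,
    then every factor of [x] can be continued in two ways inside [x], and a
    diagonal argument shows that no sequence of points exhausts the closure
    ([factor_branches], [uncountable_orbit_closure]).

    Both properties pass from a bounded sequence [b] of block lengths to the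
    word 1^(b 0) 0 1^(b 1) 0 ..., since the zeros of that word mark the block
    ends and hence determine [b] ([block_seq_uniformly_recurrent],
    [eventually_periodic_block_seq]); and recoding the letters 0, 1, 2 by
    distinct numbers is harmless.  It remains to treat [theta].  The
    Thue-Morse sequence is self-similar, M_(j 2^k + t) = M_j + M_t mod 2 for
    t < 2^k ([thue_morse_block]), and this yields both the recurrence of
    prefixes of [theta], including the exceptional letter [theta 0]
    ([theta_uniformly_recurrent]), and a descent that halves any eventual
    period ([theta_aperiodic]).

    The disjoint family consists of the [alpha p q r] with
    (p, q, r) = (3k+1, 3k+2, 3k+3).  For k < l, all full blocks of 1s of the
    l-th sequence are longer than all blocks of the k-th, and this is visible
    in every sufficiently long window ([disjoint_orbit_closures]). *)

(** * Uniformly recurrent sequences *)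

Definition tail (T : Type) (n : nat) (x : nat -> T) : nat -> T :=
  fun t => x (n + t)%N.

Definition agree (T : Type) (L : nat) (x y : nat -> T) : Prop :=
  forall t, (t < L)%N -> x t = y t.

(** Only prefixes are required to recur, which suffices because every factor
    lies in a prefix; the gap [G] depends on the length alone. *)
Definition uniformly_recurrent (T : Type) (x : nat -> T) : Prop :=
  forall L, exists G, forall i,
    exists2 j, (i <= j <= i + G)%N & agree L (tail j x) x.

Definition eventually_periodic (T : Type) (x : nat -> T) : Prop :=
  exists N P, (0 < P)%N /\ forall t, (N <= t)%N -> x (t + P)%N = x t.

Lemma uniformly_recurrent_comp (T U : Type) (f : T -> U) (x : nat -> T) :
  uniformly_recurrent x -> uniformly_recurrent (f \o x).
Proof.
move=> urx L; have [G H] := urx L; exists G => i.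
by have [j ij xj] := H i; exists j => // t /xj /= <-.
Qed.

Lemma eventually_periodic_inj (T U : Type) (f : T -> U) (x : nat -> T) :
  injective f -> eventually_periodic (f \o x) -> eventually_periodic x.
Proof.
by move=> f_inj [N [P [P0 per]]]; exists N, P; split=> // t /per /f_inj.
Qed.

(** * Orbit closures in the Cantor space *)

Section Cylinders.
Implicit Types (x y : cantor_space) (U : set cantor_space).

Lemma nbhs_cylinder x L : nbhs x [set y : cantor_space | agree L y x].
Proof.
elim: L => [|L IHL]; first by apply: filterS filterT.
have xL : nbhs x [set y : cantor_space | y L = x L].
  have /(_ [set x L]) := @proj_continuous nat (fun _ => bool) L x.
  by apply; apply: open_nbhs_nbhs; split=> //; exact: discrete_open.
apply: filterS (filterI IHL xL) => y [/= yx yL] t.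
by rewrite ltnS leq_eqVlt => /predU1P[->//|]; exact: yx.
Qed.

(** The filter generated by the cylinders around [x] converges to [x]
    coordinatewise, hence in the product topology; so it refines the
    neighbourhood filter. *)
Lemma cylinder_sub_nbhs x U :
  nbhs x U -> exists L, forall y, agree L y x -> U y.
Proof.
pose F :=
  filter_from [set: nat] (fun L => [set y : cantor_space | agree L y x]).
have FF : Filter F.
  apply: filter_from_filter; first by exists 0%N.
  move=> i j _ _; exists (maxn i j) => // y /= yx.
  by split=> t lt_t; apply: yx; rewrite leq_max lt_t ?orbT.
have Fx : F --> x.
  apply/(@pointwise_cvgP nat bool F x FF) => t A /nbhs_singleton Axt.
  by exists t.+1 => // y /= yx; rewrite /= yx.
by move=> /Fx[L _ LU]; exists L => y yx; apply: LU.
Qed.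

Lemma iter_shift_map n x : iter n shift_map x = tail n x.
Proof.
elim: n => // n IHn; apply/funext => t.
by rewrite iterS IHn /shift_map /tail addSnnS.
Qed.

Lemma orbit_closureP x y :
  orbit_closure shift_map x y <-> forall L, exists n, agree L (tail n x) y.
Proof.
split=> [cy L|H U /cylinder_sub_nbhs[L LU]].
  have [_ [[n ->]]] := cy _ (nbhs_cylinder y L).
  by rewrite iter_shift_map /= => yn; exists n.
have [n yn] := H L; exists (tail n x); split; last exact: LU.
by exists n; rewrite iter_shift_map.
Qed.

Lemma recurrent_of_uniformly x :
  uniformly_recurrent x -> recurrent shift_map x.
Proof.
move=> urx U /cylinder_sub_nbhs[L LU].
have [G /(_ 1%N)[j /andP[j_gt0 _] xj]] := urx L.
by exists j; split=> //; rewrite iter_shift_map; exact: LU.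
Qed.

(** A closed invariant [Y] inside the closure and containing some [y] contains
    [x]: with [G] the gap for the prefix of length [L], the prefix of [y] of
    length [G + L] is a factor of [x], so it contains the length [L] prefix
    of [x]. *)
Lemma minimal_of_uniformly x :
  uniformly_recurrent x -> minimal_set shift_map (orbit_closure shift_map x).
Proof.
move=> urx [Y [[YX XnY] clY [y Yy] shY]]; apply: XnY => z cz.
have Yx : Y x.
  apply: (clY) => U /cylinder_sub_nbhs[L LU].
  have [G urL] := urx L.
  have [i yi] := (orbit_closureP x y).1 (YX _ Yy) (G + L)%N.
  have [j /andP[le_ij le_jG] xj] := urL i.
  exists (tail (j - i) y); split.
    elim: (j - i)%N => // n IHn.
    rewrite -iter_shift_map iterS iter_shift_map; apply: shY.
    by exists (tail n y).
  apply: LU => t lt_tL; rewrite -xj // /tail -yi; last by lia.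
  by rewrite /tail; congr (x _); lia.
apply: clY; apply: closureS cz => _ [n ->]; elim: n => // n IHn.
by rewrite iterS; apply: shY; exists (iter n shift_map x).
Qed.

(** The prefix of length [i + L] recurs at some [k > 0], so the factor of length
    [L] at [i] occurs again at [k + i].  If the two tails coincided, then [k]
    would be an eventual period; so they differ somewhere, and at least one of
    them differs from [y]. *)
Lemma factor_branches x i L (y : cantor_space) :
    uniformly_recurrent x -> ~ eventually_periodic x ->
  exists j M, [/\ (L < M)%N, agree L (tail j x) (tail i x)
                & ~ agree M (tail j x) y].
Proof.
move=> urx aper.
have [G /(_ 1%N)[k /andP[k_gt0 _] xk]] := urx (i + L)%N.
have [t neq_t] : exists t, x (k + i + t)%N <> x (i + t)%N.
  apply/existsNP => eq_x; apply: aper; exists i, k; split=> // t le_it.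
  by rewrite -[in RHS](subnKC le_it) -eq_x; congr (x _); lia.
have agree_ki : agree L (tail (k + i) x) (tail i x).
  by move=> s lt_sL; rewrite /tail -addnA; apply: xk; rewrite ltn_add2l.
have [yt|yt] := eqVneq (y t) (x (i + t)%N).
  exists (k + i)%N, (maxn L t).+1; split=> //; first by rewrite ltnS leq_maxl.
  by move=> /(_ t); rewrite ltnS leq_maxr yt => /(_ isT).
exists i, (maxn L t).+1; split=> //; first by rewrite ltnS leq_maxl.
move=> /(_ t); rewrite ltnS leq_maxr => /(_ isT) eq_t.
by move/eqP: yt; apply.
Qed.

(** Cantor's diagonal argument: given an enumeration [e] of the closure, choose
    longer and longer factors of [x], each extending the previous one, the
    n-th avoiding the corresponding prefix of [e n].  Their limit lies in the
    closure and is not enumerated. *)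
Lemma uncountable_orbit_closure x :
    uniformly_recurrent x -> ~ eventually_periodic x ->
  ~ countable (orbit_closure shift_map x).
Proof.
move=> urx aper /pfcard_geP[X0|[e]].
  by have : set0 x by rewrite -X0; apply/orbit_closureP => L; exists 0%N.
have step (ns : nat * (nat * nat)) : exists s : nat * nat,
    [/\ (ns.2.2 < s.2)%N, agree ns.2.2 (tail s.1 x) (tail ns.2.1 x)
       & ~ agree s.2 (tail s.1 x) (e ns.1)].
  have [j [M jM]] := factor_branches ns.2.1 ns.2.2 (e ns.1) urx aper.
  by exists (j, M).
have [F FP] := choice step.
(* [u n] is the position and the length of the n-th factor. *)
pose u n := iteri n (fun k s => F (k, s)) (0%N, 0%N).
have uP n : [/\ ((u n).2 < (u n.+1).2)%N,
    agree (u n).2 (tail (u n.+1).1 x) (tail (u n).1 x)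
  & ~ agree (u n.+1).2 (tail (u n.+1).1 x) (e n)] by exact: (FP (n, u n)).
have u_mono n m : ((u n).2 <= (u (n + m)).2)%N.
  elim: m => [|m IHm]; first by rewrite addn0.
  by rewrite addnS; apply: leq_trans IHm (ltnW _); case: (uP (n + m)%N).
have u_agree n m :
    agree (u n).2 (tail (u (n + m)).1 x) (tail (u n).1 x).
  elim: m => [|m IHm] t lt_t; first by rewrite addn0.
  rewrite addnS -IHm //; have [_ -> //] := uP (n + m)%N.
  exact: leq_trans lt_t (u_mono _ _).
have u_ge n : (n <= (u n).2)%N.
  by elim: n => // n IHn; apply: leq_ltn_trans IHn _; case: (uP n).
pose z : cantor_space := fun t => tail (u t.+1).1 x t.
have zP n : agree (u n).2 (tail (u n).1 x) z.
  move=> t lt_t; rewrite /z; have [le_nt|lt_tn] := leqP n t.+1.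
    by rewrite -(subnKC le_nt) u_agree.
  by rewrite -(subnKC (ltnW lt_tn)) u_agree.
have Xz : orbit_closure shift_map x z.
  apply/orbit_closureP => L; exists (u L).1 => t lt_tL.
  by apply: zP; exact: leq_trans lt_tL (u_ge L).
have [n _ en] : (e @` [set: nat]) z by exact: surj Xz.
by have [_ _] := uP n; rewrite en; apply; exact: zP.
Qed.

End Cylinders.

(** * Sequences of blocks *)

Section Blocks.
Implicit Type b : nat -> nat.

Lemma block_wordD b n m :
  block_word b (n + m) = block_word b n ++ block_word (tail n b) m.
Proof.
rewrite /block_word /mkseq iotaD map_cat flatten_cat add0n.
by rewrite -[n in iota n m]addn0 iotaDl -map_comp.
Qed.

Lemma size_block_wordS b n :
  size (block_word b n.+1) = (size (block_word b n) + (b n).+1)%N.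
Proof. by rewrite block_wordS size_cat size_rcons size_nseq. Qed.

Lemma size_block_word_ge b n : (n <= size (block_word b n))%N.
Proof. by elim: n => // n IHn; rewrite size_block_wordS; lia. Qed.

Lemma size_block_word_mono b n m : (n <= m)%N ->
  (size (block_word b n) <= size (block_word b m))%N.
Proof. by move=> /subnKC <-; rewrite block_wordD size_cat leq_addr. Qed.

Lemma size_block_wordD_le b K n m : (forall i, b i <= K)%N ->
  (size (block_word b (n + m)) <= size (block_word b n) + m * K.+1)%N.
Proof.
move=> bK; elim: m => [|m IHm]; first by rewrite addn0; lia.
by rewrite addnS size_block_wordS; have := bK (n + m)%N; lia.
Qed.

Lemma tail_block_seq b n :
  tail (size (block_word b n)) (block_seq b) = block_seq (tail n b).
Proof.
apply/funext => t; rewrite /tail -(@nth_block_word _ (n + t.+1)).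
  by rewrite block_wordD nth_cat ltnNge leq_addr /= addKn.
by rewrite block_wordD size_cat ltn_add2l size_block_word_ge.
Qed.

Lemma block_seq_head b t : (t <= b 0)%N -> block_seq b t = (t < b 0)%N.
Proof.
move=> le_tb; have size1 : size (block_word b 1) = (b 0).+1.
  by rewrite size_block_wordS.
rewrite -(@nth_block_word _ 1) ?size1 // /block_word /= cats0.
rewrite nth_rcons size_nseq nth_nseq.
by case: (t < b 0)%N => //; case: (t == b 0).
Qed.

Lemma block_seq_split b n t :
  block_seq b (size (block_word b n) + t) = block_seq (tail n b) t.
Proof. by rewrite -tail_block_seq. Qed.

Lemma block_seq_splitS b t :
  block_seq b ((b 0).+1 + t) = block_seq (tail 1 b) t.
Proof. by rewrite -block_seq_split size_block_wordS. Qed.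

Lemma block_seq_zeroP b z :
  block_seq b z = false -> exists n, z.+1 = size (block_word b n.+1).
Proof.
elim/ltn_ind: z b => z IHz b bz.
have [lt_zb|] := ltnP z (b 0).
  by rewrite block_seq_head ?lt_zb // ltnW in bz.
rewrite leq_eqVlt => /predU1P[<-|lt_bz].
  by exists 0; rewrite size_block_wordS.
have [t zE] : exists t, z = ((b 0).+1 + t)%N by exists (z - (b 0).+1)%N; lia.
rewrite zE block_seq_splitS in bz.
have [|n nE] := IHz t _ _ bz; first by lia.
exists n.+1; rewrite -[n.+2]/(1 + n.+1)%N block_wordD size_cat -nE.
by rewrite size_block_wordS zE /=; lia.
Qed.

Lemma block_seq_zero b n :
  block_seq b (size (block_word b n) + b n) = false.
Proof. by rewrite block_seq_split block_seq_head /tail addn0 ?ltnn. Qed.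

Lemma block_seq_zero_near b K i : (forall n, b n <= K)%N ->
  exists2 j, (j <= K)%N & block_seq b (i + j) = false.
Proof.
elim/ltn_ind: i b => i IHi b bK; have [le_ib|lt_bi] := leqP i (b 0).
  exists (b 0 - i)%N; first by have := bK 0; lia.
  by rewrite subnKC // block_seq_head ?ltnn.
have [||j leK bj] := IHi (i - (b 0).+1)%N _ (tail 1 b).
- by lia.
- by move=> n; exact: bK.
exists j => //; rewrite -bj -block_seq_splitS; congr (block_seq b _); lia.
Qed.

Lemma block_seq_ones_after b m z t : (forall n, m <= b n)%N ->
  block_seq b z = false -> (t < m)%N -> block_seq b (z.+1 + t).
Proof.
move=> mb /block_seq_zeroP[n ->] lt_tm.
have lt_tb : (t < tail n.+1 b 0)%N by apply: leq_trans lt_tm (mb _).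
by rewrite block_seq_split block_seq_head // ltnW.
Qed.

Lemma agree_block_seq b b' L :
  agree L b b' -> agree L (block_seq b) (block_seq b').
Proof.
move=> bb' t lt_tL; rewrite /block_seq /block_word; congr (nth _ (flatten _) _).
apply/eq_in_map => i; rewrite mem_iota => /andP[_ lt_it]; rewrite bb' //.
by lia.
Qed.

Lemma block_seq_head_inj b b' : block_seq b =1 block_seq b' -> b 0 = b' 0.
Proof.
move=> eq_bb'; have [lt_b|lt_b|//] := ltngtP (b 0) (b' 0).
  have := eq_bb' (b 0); rewrite block_seq_head // ltnn.
  by rewrite block_seq_head ?lt_b // ltnW.
have := eq_bb' (b' 0); rewrite [RHS]block_seq_head // ltnn.
by rewrite block_seq_head ?lt_b // ltnW.
Qed.

Lemma block_seq_inj b b' : block_seq b =1 block_seq b' -> b =1 b'.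
Proof.
move=> eq_bb' n; have eq0 := block_seq_head_inj eq_bb'.
elim: n b b' eq_bb' eq0 => [//|n IHn] b b' eq_bb' eq0.
have eq_tail : block_seq (tail 1 b) =1 block_seq (tail 1 b').
  by move=> t; rewrite -!block_seq_splitS eq0.
exact: IHn eq_tail (block_seq_head_inj eq_tail).
Qed.

(** Within [K.+1] letters of any position a block starts, say block [n.+1];
    the prefix of [b] recurs at most [G] blocks later, that is at most
    [G * K.+1] letters later.  The first [L] blocks cover [L] letters. *)
Lemma block_seq_uniformly_recurrent b K : (forall n, b n <= K)%N ->
  uniformly_recurrent b -> uniformly_recurrent (block_seq b).
Proof.
move=> bK urb L; have [G urG] := urb L.
exists (K.+1 + G * K.+1)%N => i.
have [j le_jK /block_seq_zeroP[n nE]] := block_seq_zero_near i bK.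
have [m /andP[le_nm le_mG] bm] := urG n.+1.
exists (size (block_word b m)); last first.
  by rewrite tail_block_seq; exact: agree_block_seq.
have := size_block_word_mono b le_nm.
have := size_block_wordD_le n.+1 (m - n.+1) bK; rewrite subnKC // -nE.
have : ((m - n.+1) * K.+1 <= G * K.+1)%N by rewrite leq_mul2r; lia.
by lia.
Qed.

(** Translating by the period maps a zero far enough out to a zero, hence one
    block boundary to another; the two tails starting there have equal letters
    and so equal block lengths. *)
Lemma eventually_periodic_block_seq b :
  eventually_periodic (block_seq b) -> eventually_periodic b.
Proof.
move=> [N [P [P_gt0 per]]].
have sN := size_block_word_ge b N.
have [m mE] : exists m,
    (size (block_word b N.+1) + P)%N = size (block_word b m.+1).
  have [|m mE] := @block_seq_zeroP b (size (block_word b N) + b N + P).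
    by rewrite per ?block_seq_zero //; lia.
  by exists m; rewrite -mE size_block_wordS; lia.
have lt_Nm : (N < m)%N.
  rewrite ltnNge; apply/negP => le_mN.
  by have := size_block_word_mono b (le_mN : m < N.+1)%N; lia.
have eq_tail : tail m.+1 b =1 tail N.+1 b.
  apply: block_seq_inj => t; rewrite -!block_seq_split -mE addnAC per //.
  by have := size_block_word_ge b N.+1; lia.
exists N.+1, (m - N)%N; split; first by lia.
move=> t le_Nt; have := eq_tail (t - N.+1)%N.
by rewrite /tail subnKC // => <-; congr b; lia.
Qed.

(** A common point [z] of the closures starts with a factor of length
    [K' + K.+2] of each sequence.  On the side of [b'], a zero occurs among the
    first [K'.+1] letters and is followed by [K.+1] ones; on the side of [b],
    these [K.+1] letters must contain a zero. *)
Lemma disjoint_orbit_closures b b' K :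
    (forall n, b n <= K)%N -> (forall n, K < b' n)%N ->
    (exists K', forall n, b' n <= K')%N ->
  orbit_closure shift_map (block_seq b) `&`
    orbit_closure shift_map (block_seq b') = set0.
Proof.
move=> bK b'K [K' b'K']; apply/seteqP; split=> // z.
move=> [/orbit_closureP cz /orbit_closureP c'z].
have [i zi] := cz (K' + K.+2)%N; have [i' zi'] := c'z (K' + K.+2)%N.
have [j le_jK' bj] := block_seq_zero_near i' b'K'.
have [k le_kK bk] := block_seq_zero_near (i + j.+1) bK.
have lt_jk : (j.+1 + k < K' + K.+2)%N by lia.
have := @block_seq_ones_after b' K.+1 _ k b'K bj.
rewrite ltnS le_kK => /(_ isT).
have := zi' _ lt_jk; rewrite -(zi _ lt_jk) /tail !addnA bk.
by rewrite addnS => ->.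
Qed.

End Blocks.

(** * The Thue-Morse sequence and its recoding *)

Lemma thue_morse0 : thue_morse 0 = false.
Proof. by []. Qed.

Lemma thue_morse_add m s : s < 2 ^ m ->
  thue_morse (2 ^ m + s) = ~~ thue_morse s.
Proof.
move=> lt_s; rewrite -(@nth_tm_word m.+1) /= ?expnS; last by lia.
rewrite nth_cat size_tm_word ltnNge leq_addr /= addKn.
by rewrite (nth_map false) ?size_tm_word // nth_tm_word.
Qed.

(** Strip the leading binary digit of [j], which is also the leading digit of
    [j * 2 ^ k + t]. *)
Lemma thue_morse_block k j t : t < 2 ^ k ->
  thue_morse (j * 2 ^ k + t) = thue_morse j (+) thue_morse t.
Proof.
move=> lt_t; elim/ltn_ind: j => -[|j] IH; first by rewrite mul0n.
have /andP[lej ltj] := trunc_log_bounds (isT : 1 < 2) (ltn0Sn j).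
set m := trunc_log 2 j.+1 in lej ltj.
have [s jE] : exists s, j.+1 = 2 ^ m + s by exists (j.+1 - 2 ^ m); lia.
rewrite jE expnS in IH ltj *.
rewrite mulnDl -expnD -addnA !thue_morse_add; try lia.
  rewrite IH; first by case: thue_morse; case: thue_morse.
  by have := expn_gt0 2 m; lia.
by rewrite expnD; nia.
Qed.

Lemma thue_morse_double n (b : bool) :
  thue_morse (n * 2 + b) = thue_morse n (+) b.
Proof. by rewrite (@thue_morse_block 1) /=; case: b. Qed.

Lemma pow4 m : 2 ^ (2 * m) = 4 ^ m.
Proof. by rewrite expnM. Qed.

Lemma thue_morse_last m : thue_morse (4 ^ m).-1 = false.
Proof.
elim: m => // m IH.
have -> : (4 ^ m.+1).-1 = 3 * 2 ^ (2 * m) + (4 ^ m).-1.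
  by rewrite expnS pow4; have := expn_gt0 4 m; lia.
by rewrite thue_morse_block ?IH // pow4; have := expn_gt0 4 m; lia.
Qed.

Lemma thetaS n :
  theta n.+1 = if thue_morse n.+1 == thue_morse n then inord 2
               else inord (thue_morse n.+1 : nat).
Proof. by []. Qed.

Lemma theta_eq2 n : (theta n.+1 == inord 2) = (thue_morse n.+1 == thue_morse n).
Proof.
rewrite thetaS; case: (thue_morse n.+1 == _); first exact: eqxx.
by rewrite -val_eqE /= !inordK; case: thue_morse.
Qed.

(** The letter [theta n] reads M_(n-1) and M_n, so the prefix of [theta] of
    length [L <= B = 4 ^ L] recurs at [n] as soon as the prefix of M of length
    [B] occurs at [n] preceded by a 1; the 1 is what reproduces the letter
    [theta 0 = 0].  At [n = j * B] the block of length [B] is the prefix of M if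
    M_j = 0, and the letter before it is M_(j-1) because the last letter of the
    prefix of length [4 ^ L] is 0.  So it suffices that M_(j-1) M_j = 10, and
    this word occurs in each aligned quadruple 0110 or 1001 of letters of M: at
    [j = 4 * a + 3] and [j = 4 * a + 1] respectively. *)
Lemma theta_uniformly_recurrent : uniformly_recurrent theta.
Proof.
move=> L; set B := 4 ^ L.
have LB : L < B by exact: ltn_expl.
exists (8 * B) => i.
pose a := (i %/ (4 * B)).+1.
pose j := if thue_morse (4 * a) then 4 * a + 1 else 4 * a + 3.
have jB : j * B = j * 2 ^ (2 * L) by rewrite pow4.
have tm_j (c : nat) : c < 4 ->
    thue_morse (4 * a + c) = thue_morse (4 * a) (+) thue_morse c.
  move=> ltc; have := @thue_morse_block 2 a 0 isT.
  rewrite addn0 -[2 ^ 2]/4 mulnC => ->.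
  by rewrite mulnC (@thue_morse_block 2) // thue_morse0 addbF.
have j_gt0 : 0 < j by rewrite /j; case: ifP; lia.
have Mj : thue_morse j = false.
  by rewrite /j; case: ifP => E; rewrite tm_j // E.
have Mj1 : thue_morse j.-1 = true.
  rewrite /j; case: ifP => E; first by rewrite addn1.
  by rewrite addnS /= tm_j // E.
have Mpre t : t < B -> thue_morse (j * B + t) = thue_morse t.
  by move=> lt; rewrite jB thue_morse_block ?Mj // pow4.
have Mpred : thue_morse (j * B).-1 = true.
  have -> : (j * B).-1 = j.-1 * 2 ^ (2 * L) + B.-1 by rewrite pow4 -/B; nia.
  rewrite thue_morse_block ?pow4; last by rewrite -/B; lia.
  by rewrite Mj1 thue_morse_last.
exists (j * B).
  have := divn_eq i (4 * B); have := @ltn_pmod i (4 * B).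
  rewrite /j /a; move: (i %/ _) (i %% _) => u v; case: ifP => _; nia.
rewrite /tail => -[|t] lt_t.
  rewrite addn0; have -> : j * B = (j * B).-1.+1 by nia.
  rewrite thetaS prednK; last by nia.
  by rewrite Mpred; have := Mpre 0; rewrite addn0 => ->; last by lia.
by rewrite addnS !thetaS -addnS !Mpre //; lia.
Qed.

(** Let [e n] say whether M_(n+1) = M_n, that is whether the letter of [theta]
    at [n.+1] is 2.  Then [e] vanishes at even indices and its values at odd
    indices are those of the negation of [e].  An odd eventual period would
    carry the zeros to the odd indices and make [e] eventually zero, against
    the second rule; an even one would give half of itself as a period. *)
Lemma theta_aperiodic : ~ eventually_periodic theta.
Proof.
pose e n := thue_morse n.+1 == thue_morse n.
have eD n : e (n * 2) = false.
  rewrite /e; have := thue_morse_double n true; rewrite addn1 => ->.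
  by have := thue_morse_double n false; rewrite addn0 => ->; case: thue_morse.
have eS n : e (n * 2).+1 = ~~ e n.
  rewrite /e -[(n * 2).+2]/(n.+1 * 2).
  have := thue_morse_double n true; rewrite addn1 => ->.
  have := thue_morse_double n.+1 false; rewrite addn0 => ->.
  by case: thue_morse; case: thue_morse.
suff H P : 0 < P -> forall N, ~ forall t, N <= t -> e (t + P) = e t.
  case=> N [P [P0 per]]; apply: (H P P0 N) => t leNt.
  by rewrite /e -!theta_eq2 -addSn per // leqW.
elim/ltn_ind: P => P IH P_gt0 N per.
have := odd_double_half P; case: (odd P) => /= PE.
  have e0 k : N <= k -> e (k * 2).+1 = false.
    move=> leN; rewrite -[RHS](eD (k + P./2.+1)) -per; last by lia.
    by congr e; lia.
  by have := eS (N * 2).+1; rewrite !e0 //; lia.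
apply: (IH P./2 _ _ N); [lia|lia|] => t leN.
apply: negb_inj; rewrite -!eS.
have -> : ((t + P./2) * 2).+1 = (t * 2).+1 + P by lia.
by apply: per; lia.
Qed.

(** * The sequences alpha *)

Lemma beta_ind p q r (P : pred nat) n :
  P p -> P q -> P r -> P (beta p q r n).
Proof.
move=> Pp Pq Pr; have : beta p q r n \in [tuple p; q; r] by exact: mem_tnth.
by rewrite !inE => /or3P[] /eqP ->.
Qed.

Lemma beta_le p q r n : (beta p q r n <= maxn p (maxn q r))%N.
Proof. by apply: (@beta_ind p q r (fun v => v <= _)%N); lia. Qed.

Lemma alpha_uniformly_recurrent p q r : uniformly_recurrent (alpha p q r).
Proof.
apply: (block_seq_uniformly_recurrent (@beta_le p q r)).
exact: uniformly_recurrent_comp theta_uniformly_recurrent.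
Qed.

Lemma alpha_aperiodic p q r :
  distinct_pos p q r -> ~ eventually_periodic (alpha p q r).
Proof.
move=> /and5P[_ _ _ pq /andP[pr qr]] /eventually_periodic_block_seq.
move=> /eventually_periodic_inj per; apply: theta_aperiodic; apply: per.
by apply/tuple_uniqP; rewrite /= !inE negb_or pq pr qr.
Qed.

Lemma disjoint_alpha_triples k l : (k < l)%N ->
  orbit_closure shift_map (alpha (3 * k).+1 (3 * k).+2 (3 * k).+3) `&`
    orbit_closure shift_map (alpha (3 * l).+1 (3 * l).+2 (3 * l).+3) = set0.
Proof.
move=> lt_kl; apply: (@disjoint_orbit_closures _ _ (3 * k).+3).
- by move=> n; apply: (@beta_ind _ _ _ (fun v => v <= _)%N); lia.
- by move=> n; apply: (@beta_ind _ _ _ (fun v => _ < v)%N); lia.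
- by eexists; exact: beta_le.
Qed.

Theorem mainTheorem3 :
  (forall p q r : nat, distinct_pos p q r ->
     [/\ recurrent shift_map (alpha p q r),
         minimal_set shift_map (orbit_closure shift_map (alpha p q r))
       & ~ countable (orbit_closure shift_map (alpha p q r))]) /\
  (exists S : set cantor_space,
     [/\ infinite_set S,
         (forall x : cantor_space, S x ->
            exists p q r : nat, distinct_pos p q r /\ x = alpha p q r)
       & (forall x y : cantor_space, S x -> S y -> x <> y ->
            orbit_closure shift_map x `&` orbit_closure shift_map y = set0)]).
Proof.
split=> [p q r dpqr|].
  have ur := alpha_uniformly_recurrent p q r; split.
  - exact: recurrent_of_uniformly.
  - exact: minimal_of_uniformly.
  - exact: uncountable_orbit_closure ur (alpha_aperiodic dpqr).
pose a k := alpha (3 * k).+1 (3 * k).+2 (3 * k).+3.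
have disj k l : k != l -> orbit_closure shift_map (a k) `&`
    orbit_closure shift_map (a l) = set0.
  rewrite neq_ltn => /orP[|] lt_kl; last rewrite setIC.
  - exact: disjoint_alpha_triples.
  - exact: disjoint_alpha_triples.
have a_inj : injective a.
  move=> k l akl; apply/eqP; apply: contraT => /disj.
  rewrite akl setIid => cl0.
  suff : set0 (a l) by [].
  by rewrite -cl0; apply/orbit_closureP => L; exists 0%N.
exists (range a); split.
- rewrite (eq_finite_set (inj_card_eq _)); first exact: infinite_nat.
  by move=> k l _ _; exact: a_inj.
- move=> _ [k _ <-]; exists (3 * k).+1, (3 * k).+2, (3 * k).+3; split=> //.
  by rewrite /distinct_pos; lia.
- move=> _ _ [k _ <-] [l _ <-] neq_kl; apply: disj.
  by apply: contra_notN neq_kl => /eqP ->.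
Qed.
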